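(* Let $k$ be an even positive integer, let $\pi=\{V_1,\ldots,V_{k/2}\}\in\mathcal{P}_2(k)$, and consider the permutations $\tau_\pi\in S_{(k+2)/2}$ and $\sigma_\pi\in S_k$ associated to $\pi$. Let $\eta_{k+1}=(1,2,\ldots,k,k+1)$ and consider the decomposition $$\{1,\ldots,k+1\}=R_1\cup\cdots\cup R_p$$ of $\{1,\ldots,k+1\}$ into orbits of $\eta_{k+1}\cdot\sigma_\pi\in S_{k+1}$. Then the decomposition of $\{1,\ldots,(k+2)/2\}$ into orbits of $\tau_\pi$ has $p$ orbits, of cardinalities $|R_1\cap B|,\ldots,|R_p\cap B|$ (in some order), where $$B:=\{\max(V_i)\mid 1\le i\le k/2\}\cup\{k+1\}.$$
   Context: $\mathcal{P}_2(k)$ is the set of pair-partitions of $\{1,\ldots,k\}$ (partitions all of whose blocks have exactly 2 elements). Products of permutations are compositions, read right to left. $\gamma_n:=(1,n+1)$ denotes the $n$-th star-transposition. $S_m$ is viewed inside $S_{m+1}$ in the usual way. For $\pi\in\mathcal{P}_2(k)$, list its pairs $V_1,\ldots,V_{k/2}$ in decreasing order of their maximal elements. * $\sigma_\pi\in S_k$ is the product of the disjoint transpositions $(a,b)$, one for each pair $\{a,b\}\in\pi$. * $\tau_\pi:=\gamma_{\underline{r}(1)}\gamma_{\underline{r}(2)}\cdots\gamma_{\underline{r}(k)}$, where $\underline{r}(h)=i$ for $h\in V_i$, $1\le i\le k/2$. This is a permutation in $S_{(k+2)/2}$. *)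

(* Defs.v *)
From HB Require Import structures.
From mathcomp Require Import all_boot all_fingroup.

Set Implicit Arguments.
Unset Strict Implicit.
Unset Printing Implicit Defensive.

(* The set {1, ..., m} is represented by 'I_m, the number j being represented
   by the ordinal of value j - 1.  Permutations of {1, ..., m} are 'S_m.
   Products of permutations are meant as compositions read right to left,
   whereas MathComp's (s * t)%g applies s first: every product below is
   therefore written with its factors in the reverse order. *)

Definition pair_partition (k : nat) (pi : {set {set 'I_k}}) : bool :=
  partition pi [set: 'I_k] && [forall V in pi, #|V| == 2].

Definition block_max (k : nat) (V : {set 'I_k}) : nat := \max_(i in V) i.

(* The sequence V_1, ..., V_{k/2}. *)
Definition blocks (k : nat) (pi : {set {set 'I_k}}) : seq {set 'I_k} :=
  sort [rel V W | block_max W <= block_max V] (enum pi).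

(* r(h) = i for h \in V_i, with i counted from 1. *)
Definition block_rank (k : nat) (pi : {set {set 'I_k}}) (h : 'I_k) : nat :=
  (index (pblock pi h) (blocks pi)).+1.

(* gamma_n = (1, n+1) in S_{m+1}, for 1 <= n <= m. *)
Definition star_transposition (m n : nat) : 'S_m.+1 := tperm ord0 (inord n).

(* gamma_{r(1)} ... gamma_{r(k)} in S_{(k+2)/2}; note (k+2)/2 = k/2 + 1. *)
Definition tau (k : nat) (pi : {set {set 'I_k}}) : 'S_(k./2.+1) :=
  (\prod_(h <- rev (enum 'I_k)) star_transposition k./2 (block_rank pi h))%g.

(* The condition p.1 < p.2 makes each pair of pi contribute exactly once. *)
Definition sigma (k : nat) (pi : {set {set 'I_k}}) : 'S_k :=
  (\prod_(p : 'I_k * 'I_k | (p.1 < p.2) && ([set p.1; p.2] \in pi))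
     tperm p.1 p.2)%g.

(* The usual embedding of S_m in S_{m+1}: the last point is fixed. *)
Definition extend_perm (m : nat) (s : 'S_m) : 'S_m.+1 :=
  lift_perm ord_max ord_max s.

(* The cycle (1, 2, ..., m). *)
Definition long_cycle (m : nat) : 'S_m := perm (@ordS_inj m).

(* The composition eta_{k+1} . sigma_pi, in which sigma_pi acts first. *)
Definition eta_sigma (k : nat) (pi : {set {set 'I_k}}) : 'S_k.+1 :=
  (extend_perm (sigma pi) * long_cycle k.+1)%g.

Definition B_set (k : nat) (pi : {set {set 'I_k}}) : {set 'I_k.+1} :=
  [set inord (block_max V) | V in pi] :|: [set ord_max].

(* Main.v *)
Require Import Defs.
From mathcomp Require Import all_boot all_fingroup.

(* Let T be the inverse of eta_{k+1} sigma_pi: T y = sigma_pi(y - 1) for y > 1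
   and T 1 = k + 1.  Label the points of {1, ..., k/2 + 1} by B, giving 1 the
   label k + 1 and i + 1 the label max V_i.  Applying gamma_{r(k)}, ...,
   gamma_{r(1)} in turn to a point x, the point rests at some i + 1 until it is
   brought to 1 by an index j of V_i, and the next factor gamma_{r(j-1)} takes
   it to the place of the block containing j - 1 and sigma_pi(j - 1) = T j.  So
   the walk of x follows the T-orbit of its label, and it stops the first time
   this orbit is back in B: tau_pi is the first return map of T to B.  Since
   T y < y whenever T y is outside B, every orbit of T meets B, and the orbits
   of tau_pi are the traces on B of those of T. *)

Set Implicit Arguments.
Unset Strict Implicit.
Unset Printing Implicit Defensive.

(** * First return maps and their orbits *)

(* When phi is injective, u is the first return map of s to the image of phi. *)
Definition first_return (S T : finType) (s : {perm T}) (phi : S -> T)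
    (u : {perm S}) : Prop :=
  forall x, exists2 n, phi (u x) = (s ^+ n.+1)%g (phi x) &
    forall m, 0 < m <= n -> (s ^+ m)%g (phi x) \notin codom phi.

(** One step of [u] is a positive power of [s]. Conversely, a positive exponent of [s] leading from
    [phi x] to [phi y] cannot be smaller than the return time of [x], so subtracting that time
    replaces [x] by [u x] and lowers the exponent. *)
Lemma first_return_porbit (S T : finType) (s : {perm T}) (phi : S -> T)
    (u : {perm S}) :
    injective phi -> first_return s phi u ->
  forall x y, (phi y \in porbit s (phi x)) = (y \in porbit u x).
Proof.
move=> phi_inj ret x y; apply/idP/idP.
  case/porbitP=> m; elim/ltn_ind: m x => -[|m] IHm x.
    by rewrite expg0 perm1 => /phi_inj->; apply: porbit_id.
  have [n eq_n n_out] := ret x.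
  have [lt_mn | le_nm] := ltnP m n => eq_m.
    by have := n_out m.+1 lt_mn; rewrite -eq_m codom_f.
  have: y \in porbit u (u x).
    apply: (IHm (m - n)); first by rewrite ltnS leq_subr.
    by rewrite eq_n -permM -expgD addSn subnKC.
  by have := porbit_perm u 1 x; rewrite expg1 => ->.
case/porbitP=> m ->; elim: m => [|m IHm].
  by rewrite expg0 perm1 porbit_id.
have [n eq_n _] := ret ((u ^+ m)%g x).
rewrite expgSr permM eq_n porbit_sym porbit_perm porbit_sym.
exact: IHm.
Qed.

(** Every orbit of [s] contains some [phi x], so taking preimages under [phi] is a bijection from
    the orbits of [s] to those of [u]; injectivity of [phi] turns the size of a preimage into that
    of a trace. *)
Lemma first_return_porbits (S T : finType) (s : {perm T}) (phi : S -> T)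
    (u : {perm S}) :
    injective phi -> first_return s phi u ->
    (forall y, exists x, phi x \in porbit s y) ->
  #|porbits u| = #|porbits s| /\
  perm_eq [seq #|A| | A : {set S} <- enum (porbits u)]
          [seq #|R :&: [set phi x | x : S]| | R : {set T} <- enum (porbits s)].
Proof.
move=> phi_inj ret hit.
have preim_porbit x : phi @^-1: porbit s (phi x) = porbit u x.
  by apply/setP=> y; rewrite inE (first_return_porbit phi_inj ret).
have porbitsE R : R \in porbits s -> exists x, R = porbit s (phi x).
  case/imsetP=> y _ ->; have [x] := hit y.
  by rewrite -eq_porbit_mem => /eqP<-; exists x.
have preim_inj : {in porbits s &, injective (fun R : {set T} => phi @^-1: R)}.
  move=> _ _ /porbitsE[x ->] /porbitsE[y ->]; rewrite !preim_porbit => eq_xy.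
  apply/eqP; rewrite eq_porbit_mem (first_return_porbit phi_inj ret).
  by rewrite -eq_porbit_mem eq_xy.
have eq_porbits : porbits u = [set phi @^-1: (R : {set T}) | R in porbits s].
  apply/setP=> A; apply/imsetP/imsetP=> [[x _ ->] | [_ /porbitsE[x ->] ->]].
    by exists (porbit s (phi x)); rewrite ?imset_f ?preim_porbit.
  by exists x; rewrite ?preim_porbit.
split; first by rewrite eq_porbits card_in_imset.
have perm_enum : perm_eq (enum (porbits u))
                         [seq phi @^-1: R | R : {set T} <- enum (porbits s)].
  apply: uniq_perm; first exact: enum_uniq.
    rewrite map_inj_in_uniq ?enum_uniq // => R R'; rewrite !mem_enum.
    exact: preim_inj.
  move=> A; rewrite mem_enum eq_porbits.
  apply/imsetP/mapP=> -[R R_s ->]; exists R => //.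
    by rewrite mem_enum.
  by rewrite -mem_enum.
apply: (perm_trans (perm_map _ perm_enum)); rewrite -map_comp.
apply/seq.permP=> a; congr count; apply: eq_map => R /=.
rewrite -(card_imset _ phi_inj); apply: eq_card => y; rewrite in_setI.
apply/imsetP/andP=> [[x + ->] | [Ry /imsetP[x _ eq_y]]].
  by rewrite inE => Rx; rewrite imset_f.
by exists x; rewrite ?inE -?eq_y.
Qed.

(** * The walk on the star *)

(** A pair-partition enters only as a fixed-point-free involution [sg], with its pairs numbered by
    [r] and labelled by [phi]; [ord0] is the centre of the star. *)
Lemma star_first_return (k m : nat) (sg : {perm 'I_k}) (r : 'I_k -> 'I_m.+1)
    (phi : 'I_m.+1 -> 'I_k.+1) :
    (forall h, sg (sg h) = h) -> (forall h, sg h != h) ->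
    (forall h, r h != ord0) ->
    (forall h, r (sg h) = r h) ->
    (forall h h', r h = r h' -> h' = h \/ h' = sg h) ->
    (forall p, p != ord0 -> exists h, r h = p) ->
    phi ord0 = ord_max ->
    (forall h, phi (r h) = maxn h (sg h) :> nat) ->
  let s := ((extend_perm sg * long_cycle k.+1)^-1)%g in
  injective phi /\
  first_return s phi (\prod_(h <- rev (enum 'I_k)) tperm ord0 (r h))%g /\
  (forall y, exists x, phi x \in porbit s y).
Proof.
move=> sgK sgN r0 r_sg r_inj r_surj phi0 phir s.
pose w (h : 'I_k) : 'I_k.+1 := lift ord_max h.
have wE h : w h = h :> nat by rewrite lift_max.
have w_inj : injective w by apply: lift_inj.
have s0 : s ord0 = ord_max.
  apply: (canLR (permK _)).
  rewrite permM /extend_perm lift_perm_id permE.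
  by apply: val_inj; rewrite /= modnn.
have sS (h : 'I_k) : s (inord h.+1) = w (sg h).
  apply: (canLR (permK _)).
  rewrite permM /extend_perm lift_perm_lift sgK permE.
  apply: ord_inj; rewrite inordK ?ltnS // -[RHS]/((w h).+1 %% k.+1).
  by rewrite wE modn_small ?ltnS.
have r_max p : p != ord0 -> exists h, [/\ p = r h, sg h < h & phi p = w h].
  move=> /r_surj[h <-].
  have [lt_h|le_h] := ltnP (sg h) h.
    exists h; split=> //; apply: ord_inj; rewrite phir wE.
    by apply/maxn_idPl/ltnW.
  exists (sg h); rewrite r_sg sgK; split=> //.
    rewrite ltn_neqAle le_h andbT eq_sym.
    by apply: contraNneq (sgN h) => /val_inj->.
  by apply: ord_inj; rewrite phir wE; apply/maxn_idPr.
have min_out (h : 'I_k) : h < sg h -> w h \notin codom phi.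
  move=> lt_h; apply/codomP=> -[p].
  have [-> | /r_max[h' [_ lt_h' ->]]] := eqVneq p ord0.
    by rewrite phi0 => /eqP; rewrite eq_sym (negPf (neq_lift _ _)).
  by move=> /w_inj eq_h; move: lt_h'; rewrite -eq_h ltnNge ltnW.
have phi_inj : injective phi.
  move=> p q; have [-> | /r_max[h [-> _ ->]]] := eqVneq p ord0.
    have [-> // | /r_max[h [_ _ ->]]] := eqVneq q ord0.
    by rewrite phi0 => /eqP; rewrite (negPf (neq_lift _ _)).
  have [-> | /r_max[h' [-> _ ->]]] := eqVneq q ord0.
    by rewrite phi0 => /eqP; rewrite eq_sym (negPf (neq_lift _ _)).
  by move/w_inj->.
split=> //; split; last first.
  (* Descent: from [j.+1], one step of [s] reaches either the larger element of a pair, which is a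
     label, or a smaller point. *)
  case=> j; elim/ltn_ind: j => -[|j] IHj lt_j.
    exists ord0; rewrite phi0 -s0 (_ : Ordinal _ = ord0) ?(mem_porbit s 1) //.
    exact: val_inj.
  pose h := Ordinal (lt_j : j < k).
  have eq_sy : s (Ordinal lt_j) = w (sg h).
    by rewrite -sS; congr (s _); apply: ord_inj; rewrite inordK ?ltnS.
  have porbit_s y : porbit s (s y) = porbit s y.
    by have := porbit_perm s 1 y; rewrite expg1.
  rewrite -porbit_s eq_sy.
  have [lt_h | le_h] := ltnP h (sg h).
    exists (r h); rewrite (_ : phi (r h) = w (sg h)) ?porbit_id //.
    by apply: ord_inj; rewrite phir wE; apply/maxn_idPr/ltnW.
  have lt_sg : w (sg h) < j.+1 by rewrite wE ltnS.
  have [x] := IHj _ lt_sg (ltn_ord _).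
  by rewrite (_ : Ordinal _ = w (sg h)); [exists x | apply: val_inj].
(* Extending [sg] lets it act on labels: away from [ord0], [e (phi p)] is the smaller element of the
   pair located at [p]. *)
pose e := extend_perm sg.
have eE h : e (w h) = w (sg h) by rewrite /e /extend_perm lift_perm_lift.
(* P j is the product of the factors of index at least j, and L j p is the
   element of the T-orbit carried by the point standing at p after P j: j itself
   at the centre of the star, and for the location of a block {a < b} either a,
   when b is already processed but not a, or b. *)
pose L j p := if p == ord0 then inord j else
  if e (phi p) < j <= phi p then e (phi p) else phi p.
pose P j := (\prod_(h <- rev (drop j (enum 'I_k))) tperm ord0 (r h))%g.
(* n counts the factors that have moved the point away from ord0. *)
have inv x d j : d + j = k -> exists n,
  [/\ L j (P j x) = (s ^+ n)%g (phi x),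
      forall i, 0 < i < n -> (s ^+ i)%g (phi x) \notin codom phi &
      (* At the centre the carried element is either still the initial label or no label at all, so
         leaving the centre never skips a return. Elsewhere [n = 0] exactly when the larger index of
         the block is unprocessed, the point then never having moved. *)
      if P j x == ord0 then n = 0 \/ inord j \notin codom phi
      else (n == 0) = (phi (P j x) < j)].
  elim: d j => [|d IHd] j; [rewrite add0n => -> | move=> def_k].
    exists 0; rewrite /P drop_oversize ?size_enum_ord // big_nil !perm1.
    split; [| by case | ].
      rewrite /L; case: (eqVneq x ord0) => [-> | /r_max[h [_ lt_h ->]]].
        by rewrite phi0; apply: val_inj; rewrite /= inordK.
      by rewrite wE [k <= h]leqNgt ltn_ord andbF.
    case: (eqVneq x ord0) => [_ | /r_max[h [_ lt_h ->]]]; first by left.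
    by rewrite wE ltn_ord.
  have lt_jk : j < k by rewrite -def_k addSn ltnS leq_addl.
  pose h := Ordinal lt_jk.
  have PS : P j x = tperm ord0 (r h) (P j.+1 x).
    rewrite /P (drop_nth h) ?size_enum_ord // rev_cons -cats1 big_cat big_seq1.
    rewrite permM (_ : nth _ _ _ = h) //.
    by apply: ord_inj; rewrite nth_enum_ord.
  have [|n []] := IHd j.+1; first by rewrite addnS.
  rewrite PS; set p := P j.+1 x => eqL n_out.
  have inord_j : inord j = w h by apply: ord_inj; rewrite wE inordK // ltnW.
  case: tpermP => [p0 | p_r | /eqP p0 /eqP p_r].
  - rewrite (negPf (r0 h)) p0 eqxx => n_j; exists n.+1; split.
    (* The point leaves the centre. Whichever of the pair [h] is, the element now carried is its
       partner, the image of [j.+1] under [s]. *)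
    + have -> : L j (r h) = w (sg h).
        have [h' [eq_h' lt_h' phi_h']] := r_max _ (r0 h).
        rewrite /L (negPf (r0 h)) phi_h' eE !wE.
        have [eq_hh' | eq_hh'] := r_inj _ _ eq_h'.
          by move: lt_h'; rewrite eq_hh' => ->; rewrite leqnn.
        by rewrite eq_hh' sgK ltnn.
      by rewrite expgSr permM -eqL p0 /L eqxx -sS.
    + move=> i /andP[i_gt0]; rewrite ltnS leq_eqVlt => /orP[/eqP eq_i | lt_in].
        rewrite eq_i -eqL p0 /L eqxx.
        by case: n_j => // n0; rewrite eq_i n0 in i_gt0.
      by apply: n_out; rewrite i_gt0.
    + by rewrite phir ltnNge leq_max leqnn.
  (* The point comes to the centre already carrying [j], so [n] is unchanged. If [h] is the larger
     of its pair, the block was untouched and [n = 0]; otherwise [j] is not a label. *)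
  - rewrite eqxx p_r (negPf (r0 h)).
    have [h' [eq_h' lt_h' phi_h']] := r_max _ (r0 h).
    have := eqL; rewrite /L eqxx p_r (negPf (r0 h)).
    rewrite phi_h' eE !wE !ltnS => eqL' n_j.
    have [eq_hh' | eq_hh'] := r_inj _ _ eq_h';
      rewrite eq_hh' in lt_h' phi_h' eqL' n_j.
      exists n; split => //; first by rewrite -eqL' ltnn andbF inord_j.
      by left; apply/eqP; rewrite n_j leqnn.
    rewrite sgK in lt_h' eqL'.
    exists n; split => //; first by rewrite -eqL' leqnn lt_h' inord_j.
    by right; rewrite inord_j; apply: min_out.
  (* The point stays put: [j] is neither element of its block, so comparing these with [j] or with
     [j.+1] gives the same result. *)
  - move/negPf: p0 => p0; rewrite p0 => n_j; exists n.
    have [h' [eq_h' lt_h' phi_h']] := r_max _ (negbT p0).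
    have ne_j : h != h' by apply: contraNneq p_r => ->; rewrite eq_h'.
    have ne_sg : h != sg h' by apply: contraNneq p_r => ->; rewrite eq_h' r_sg.
    have neq_val (a b : 'I_k) : a != b -> (a < b.+1) = (a < b).
      by move=> ne_ab; rewrite ltnS leq_eqVlt (inj_eq val_inj) (negPf ne_ab).
    split=> //.
    + rewrite -eqL /L p0 phi_h' eE !wE -[j]/(h : nat).
      rewrite neq_val 1?eq_sym //.
      by rewrite [h <= h']leq_eqVlt (inj_eq val_inj) (negPf ne_j).
    + by rewrite n_j phi_h' wE -[j]/(h : nat) neq_val // eq_sym.
move=> x; have [n []] := inv x k 0 (addn0 k).
rewrite (_ : (\prod_(h <- _) _)%g = P 0); last by rewrite /P drop0.
move: (P 0 x) => y; rewrite /L.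
case: (eqVneq y ord0) => [-> | y0] eq_n n_out n_y.
  (* Ending at the centre, the point carries the least element, and one further step of [s] gives
     [ord_max], the label of [ord0]. *)
  exists n.
    rewrite expgSr permM -eq_n phi0 -s0; congr (s _).
    by apply: ord_inj; rewrite inordK.
  move=> i /andP[i_gt0]; rewrite leq_eqVlt => /orP[/eqP eq_i | lt_in].
    rewrite eq_i -eq_n; case: n_y => // n0.
    by rewrite eq_i n0 in i_gt0.
  by apply: n_out; rewrite i_gt0.
(* Ending elsewhere, the point carries the label itself, and [n] is positive because no label is
   below [0]. *)
case: n n_y eq_n n_out => // n _ eq_n n_out.
by exists n => //; rewrite -eq_n.
Qed.

(** * Products of disjoint transpositions *)

(** All the other factors fix both [a] and [b], so splitting the product at [(a, b)] leaves one
    active transposition. *)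
Lemma prod_disjoint_tperm (T : finType) (s : seq (T * T)) (a b : T) :
    uniq s -> (a, b) \in s ->
    {in s, forall q, q != (a, b) ->
      (a \notin [set q.1; q.2]) && (b \notin [set q.1; q.2])} ->
  let t := (\prod_(q <- s) tperm q.1 q.2)%g in t a = b /\ t b = a.
Proof.
move=> s_uniq s_ab s_disj.
have fix_prod (r : seq (T * T)) x : {in r, forall q, x \notin [set q.1; q.2]} ->
    (\prod_(q <- r) tperm q.1 q.2)%g x = x.
  elim: r => [|q r IHr] r_x; first by rewrite big_nil perm1.
  have := r_x q (mem_head _ _); rewrite !inE negb_or => /andP[x_q1 x_q2].
  rewrite big_cons permM tpermD 1?eq_sym // IHr // => q' r_q'.
  by apply: r_x; rewrite inE r_q' orbT.
case/splitPr: s_ab s_uniq s_disj => s1 s2.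
rewrite uniq_catC cat_cons /= mem_cat => /andP[/norP[s2_ab s1_ab] _] s_disj.
have disj1 q : q \in s1 ->
    (a \notin [set q.1; q.2]) && (b \notin [set q.1; q.2]).
  move=> s1_q; apply: s_disj; first by rewrite mem_cat s1_q.
  by apply: contraNneq s1_ab => <-.
have disj2 q : q \in s2 ->
    (a \notin [set q.1; q.2]) && (b \notin [set q.1; q.2]).
  move=> s2_q; apply: s_disj; first by rewrite mem_cat inE s2_q !orbT.
  by apply: contraNneq s2_ab => <-.
have fix1 x : x \in [:: a; b] -> (\prod_(q <- s1) tperm q.1 q.2)%g x = x.
  rewrite !inE => x_ab; apply: fix_prod => q /disj1/andP[].
  by case/orP: x_ab => /eqP->.
have fix2 x : x \in [:: a; b] -> (\prod_(q <- s2) tperm q.1 q.2)%g x = x.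
  rewrite !inE => x_ab; apply: fix_prod => q /disj2/andP[].
  by case/orP: x_ab => /eqP->.
rewrite /= big_cat big_cons !permM.
by rewrite !fix1 ?tpermL ?tpermR ?fix2 ?inE ?eqxx ?orbT.
Qed.

(** * The involution, the numbering and the labels of a pair-partition *)

Section PairPartition.

Variables (k : nat) (pi : {set {set 'I_k}}).
Hypothesis hpi : pair_partition pi.

Let partition_pi : partition pi [set: 'I_k]. Proof. by case/andP: hpi. Qed.

Let trivIset_pi : trivIset pi. Proof. by case/and3P: partition_pi. Qed.

Let card_block V : V \in pi -> #|V| = 2.
Proof. by case/andP: hpi => _ /forall_inP pi2 /pi2/eqP. Qed.

(** Blocks sharing an element coincide, and the strict order fixes which of the two ordered pairs
    occurs, so the other transpositions avoid [a] and [b]. *)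
Lemma sigma_pair (a b : 'I_k) : a != b -> [set a; b] \in pi -> sigma pi a = b.
Proof.
have swap (c d : 'I_k) : c < d -> [set c; d] \in pi ->
    sigma pi c = d /\ sigma pi d = c.
  move=> lt_cd pi_cd; rewrite /sigma -big_filter.
  apply: prod_disjoint_tperm; first by rewrite filter_uniq ?index_enum_uniq.
    by rewrite mem_filter /= lt_cd pi_cd mem_index_enum.
  move=> [x y]; rewrite mem_filter /= => /andP[/andP[lt_xy pi_xy] _] ne_q.
  rewrite -negb_or; apply: contra ne_q => q_cd.
  have eq_q : [set x; y] = [set c; d].
    by case/orP: q_cd => /(def_pblock trivIset_pi pi_xy) <-;
      apply: def_pblock; rewrite // !inE eqxx ?orbT.
  have: (c \in [set x; y]) && (d \in [set x; y]).
    by rewrite eq_q !inE !eqxx orbT.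
  rewrite !inE => /andP[/orP[] /eqP eq_c /orP[] /eqP eq_d].
  - by rewrite eq_c eq_d ltnn in lt_cd.
  - by rewrite eq_c eq_d.
  - by rewrite eq_c eq_d ltnNge ltnW in lt_cd.
  - by rewrite eq_c eq_d ltnn in lt_cd.
move=> ne_ab pi_ab; have [lt_ab | lt_ba | /val_inj eq_ab] := ltngtP a b.
- by case: (swap a b).
- by case: (swap b a); rewrite // setUC.
- by rewrite eq_ab eqxx in ne_ab.
Qed.

Lemma pblock_pi h : pblock pi h \in pi.
Proof. by rewrite pblock_mem ?(cover_partition partition_pi). Qed.

Lemma mem_pblock_pi h : h \in pblock pi h.
Proof. by rewrite mem_pblock (cover_partition partition_pi). Qed.

Lemma sigma_neq h : sigma pi h != h.
Proof.
have /cards2P[a [b [ne_ab eqV]]] := introT eqP (card_block (pblock_pi h)).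
have := mem_pblock_pi h; have := pblock_pi h; rewrite eqV => pi_ab.
rewrite !inE => /orP[] /eqP->.
  by rewrite (sigma_pair ne_ab pi_ab) eq_sym.
by rewrite (@sigma_pair b a) // 1?setUC // eq_sym.
Qed.

Lemma pblock_sigma h : pblock pi h = [set h; sigma pi h].
Proof.
have /cards2P[a [b [ne_ab eqV]]] := introT eqP (card_block (pblock_pi h)).
have := mem_pblock_pi h; have := pblock_pi h; rewrite eqV => pi_ab.
rewrite !inE => /orP[] /eqP->.
  by rewrite (sigma_pair ne_ab pi_ab).
by rewrite (@sigma_pair b a) // 1?setUC // eq_sym.
Qed.

Lemma sigmaK h : sigma pi (sigma pi h) = h.
Proof.
apply: sigma_pair; first exact: sigma_neq.
by rewrite setUC -pblock_sigma pblock_pi.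
Qed.

Lemma block_max_pblock h : block_max (pblock pi h) = maxn h (sigma pi h).
Proof.
by rewrite pblock_sigma /block_max big_setU1 ?big_set1 // inE eq_sym sigma_neq.
Qed.

Lemma mem_blocks V : (V \in blocks pi) = (V \in pi).
Proof. by rewrite mem_sort mem_enum. Qed.

Lemma blocks_uniq : uniq (blocks pi).
Proof. by rewrite sort_uniq enum_uniq. Qed.

Lemma size_blocks : size (blocks pi) = k./2.
Proof.
rewrite size_sort -cardE.
have := card_uniform_partition card_block partition_pi.
by rewrite cardsT card_ord => /(congr1 half); rewrite muln2 doubleK.
Qed.

Definition rank_location (h : 'I_k) : 'I_(k./2.+1) := inord (block_rank pi h).

(** The labelling of locations by B. The predecessor undoes the counting of ranks from 1; for a
    pair-partition the default [set0] is never reached. *)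
Definition location_max (p : 'I_(k./2.+1)) : 'I_k.+1 :=
  if p == ord0 then ord_max
  else inord (block_max (nth set0 (blocks pi) p.-1)).

Lemma rank_locationE h : rank_location h = block_rank pi h :> nat.
Proof.
rewrite inordK // /block_rank !ltnS -size_blocks index_mem.
by rewrite mem_blocks pblock_pi.
Qed.

Lemma rank_location_neq0 h : rank_location h != ord0.
Proof. by rewrite -(inj_eq val_inj) /= rank_locationE. Qed.

Lemma location_max_rank h :
  location_max (rank_location h) = maxn h (sigma pi h) :> nat.
Proof.
rewrite /location_max (negPf (rank_location_neq0 h)) rank_locationE.
rewrite /block_rank /= nth_index ?mem_blocks ?pblock_pi // block_max_pblock.
by rewrite inordK // ltnS geq_max !(ltnW (ltn_ord _)).
Qed.

Lemma rank_location_sigma h : rank_location (sigma pi h) = rank_location h.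
Proof.
by rewrite /rank_location /block_rank !pblock_sigma sigmaK setUC.
Qed.

Lemma rank_location_inj h h' :
  rank_location h = rank_location h' -> h' = h \/ h' = sigma pi h.
Proof.
move/(congr1 val); rewrite /= !rank_locationE /block_rank => -[eq_i].
have eqV : pblock pi h = pblock pi h'.
  by rewrite -(nth_index set0 (_ : pblock pi h \in blocks pi)) ?eq_i
     ?nth_index // mem_blocks pblock_pi.
have := mem_pblock_pi h'; rewrite -eqV pblock_sigma !inE.
by case/orP=> /eqP; [left | right].
Qed.

Lemma rank_location_surj p : p != ord0 -> exists h, rank_location h = p.
Proof.
case: p => -[|i] // lt_i _.
have i_lt : i < size (blocks pi) by rewrite size_blocks.
have pi_V : nth set0 (blocks pi) i \in pi by rewrite -mem_blocks mem_nth.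
have /card_gt0P[h V_h] : 0 < #|nth set0 (blocks pi) i| by rewrite card_block.
exists h; apply: ord_inj; rewrite rank_locationE /block_rank.
by rewrite (def_pblock trivIset_pi pi_V V_h) index_uniq ?blocks_uniq.
Qed.

Lemma B_set_location_max : B_set pi = [set location_max p | p : 'I_(k./2.+1)].
Proof.
have maxE h : inord (block_max (pblock pi h)) = location_max (rank_location h).
  apply: ord_inj; rewrite location_max_rank block_max_pblock inordK //.
  by rewrite ltnS geq_max !(ltnW (ltn_ord _)).
apply/setP=> y; apply/idP/imsetP.
  rewrite !inE => /orP[/imsetP[V pi_V ->] | /eqP->]; last first.
    by exists ord0; rewrite // /location_max eqxx.
  have /card_gt0P[h V_h] : 0 < #|V| by rewrite card_block.
  exists (rank_location h) => //.
  by rewrite -(def_pblock trivIset_pi pi_V V_h) maxE.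
case=> p _ ->; have [-> | /rank_location_surj[h <-]] := eqVneq p ord0.
  by rewrite /location_max eqxx !inE eqxx orbT.
by rewrite -maxE inE; apply/orP; left; apply/imsetP;
  exists (pblock pi h); rewrite ?pblock_pi.
Qed.

End PairPartition.

Theorem proposition2p11 (k : nat) (pi : {set {set 'I_k}})
    (hk : 0 < k) (hk2 : ~~ odd k) (hpi : pair_partition pi) :
  #|porbits (tau pi)| = #|porbits (eta_sigma pi)| /\
  perm_eq [seq #|A| | A : {set 'I_(k./2.+1)} <- enum (porbits (tau pi))]
          [seq #|R :&: B_set pi|
             | R : {set 'I_k.+1} <- enum (porbits (eta_sigma pi))].
Proof.
have phi0 : location_max pi ord0 = ord_max by rewrite /location_max eqxx.
have [phi_inj [ret hit]] := star_first_return (sigmaK hpi) (sigma_neq hpi)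
  (rank_location_neq0 hpi) (rank_location_sigma hpi) (rank_location_inj hpi)
  (rank_location_surj hpi) phi0 (location_max_rank hpi).
(* The walk follows the inverse of [eta_sigma pi], which has the same orbits. *)
rewrite -(porbitsV (eta_sigma pi)) (B_set_location_max hpi).
exact: first_return_porbits phi_inj ret hit.
Qed.
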